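(* Let $\mathcal F$ be a group frame. The full group relation algebra $\mathfrak{Gr}(\mathcal F)$ is simple if and only if $\mathcal F$ is simple.
   Context: A group pair consists of the following data. - Pairwise disjoint groups $G_x$ ($x\in I$), with identity $e_x$. - An equivalence relation $\mathcal E$ on $I$. - For each $(x,y)\in\mathcal E$, an isomorphism $\varphi_{xy}:G_x/H_{xy}\to G_y/K_{xy}$, where $H_{xy}\trianglelefteq G_x$ and $K_{xy}\trianglelefteq G_y$. Notation: $\circ$ is the complex product; $\varphi_{xy}[S]$ is the union of images of the $H_{xy}$-cosets contained in $S$; the map induced by $\varphi_{xy}$ modulo a normal subgroup $N\supseteq H_{xy}$ sends each coset $C$ of $N$ to $\varphi_{xy}[C]$. A group frame is a group pair such that for all $(x,y),(y,z)\in\mathcal E$: - $\varphi_{xx}$ is the identity automorphism of $G_x/\{e_x\}$; - $\varphi_{yx}=\varphi_{xy}^{-1}$; - $\varphi_{xy}[H_{xy}\circ H_{xz}]=K_{xy}\circ H_{yz}$; - applying first the map induced by $\varphi_{xy}$ on $G_x/(H_{xy}\circ H_{xz})$ and then the map induced by $\varphi_{yz}$ on $G_y/(K_{xy}\circ H_{yz})$ equals the map induced by $\varphi_{xz}$ on $G_x/(H_{xy}\circ H_{xz})$. With cosets $H_{xy,\gamma}$ ($\gamma<\kappa_{xy}$, $H_{xy,0}=H_{xy}$) enumerated without repetitions and $K_{xy,\gamma}=\varphi_{xy}(H_{xy,\gamma})$, let $R_{xy,\alpha}=\bigcup_\gamma H_{xy,\gamma}\times(K_{xy,\gamma}\circ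 K_{xy,\alpha})$. The full group relation algebra $\mathfrak{Gr}(\mathcal F)$ has as universe all unions of subfamilies of the $R_{xy,\alpha}$, with base set $U=\bigcup_x G_x$ and unit $E=\bigcup_{(x,y)\in\mathcal E}G_x\times G_y$. Its operations are union, complement relative to $E$, relational composition, converse, and the constant $\mathrm{id}_U$. A group frame is simple if $I\neq\emptyset$ and $\mathcal E=I\times I$. A relation algebra is simple if it has more than one element and every non-constant homomorphism on it is injective. *)

(* Defs.v *)
From mathcomp Require Import all_boot.
From mathcomp Require Import boolp classical_sets functions.

Set Implicit Arguments.
Unset Strict Implicit.
Unset Printing Implicit Defensive.

Local Open Scope classical_set_scope.
Local Open Scope group_scope.

(** * Relation algebras *)

(** Tarski's axioms, with Huntington's axiom as the third Boolean one. *)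
Record relation_algebra := RelationAlgebra {
  ra_sort :> Type;
  ra_add : ra_sort -> ra_sort -> ra_sort;
  ra_compl : ra_sort -> ra_sort;
  ra_comp : ra_sort -> ra_sort -> ra_sort;
  ra_conv : ra_sort -> ra_sort;
  ra_id : ra_sort;
  ra_addC : commutative ra_add;
  ra_addA : associative ra_add;
  ra_huntington : forall r s,
    ra_add (ra_compl (ra_add (ra_compl r) s))
           (ra_compl (ra_add (ra_compl r) (ra_compl s))) = r;
  ra_compA : associative ra_comp;
  ra_comp_id : right_id ra_id ra_comp;
  ra_convK : involutive ra_conv;
  ra_conv_comp : forall r s,
    ra_conv (ra_comp r s) = ra_comp (ra_conv s) (ra_conv r);
  ra_compDl : left_distributive ra_comp ra_add;
  ra_convD : {morph ra_conv : r s / ra_add r s};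
  ra_tarski : forall r s,
    ra_add (ra_comp (ra_conv r) (ra_compl (ra_comp r s))) (ra_compl s)
    = ra_compl s
}.

Record ra_homomorphism (A B : relation_algebra) (h : A -> B) : Prop := {
  ra_homD : {morph h : r s / ra_add r s};
  ra_homN : {morph h : r / ra_compl r};
  ra_homM : {morph h : r s / ra_comp r s};
  ra_homV : {morph h : r / ra_conv r};
  ra_hom1 : h (ra_id A) = ra_id B
}.

Definition ra_simple (A : relation_algebra) : Prop :=
  (exists a b : A, a <> b) /\
  forall (B : relation_algebra) (h : A -> B),
    ra_homomorphism h -> ~ (forall a b, h a = h b) -> injective h.

(** * Normal subgroups and quotients of arbitrary groups

    Elements of G/N are the cosets of N, as sets; the product of G/N is the
    complex product. *)

Definition complex_prod (G : groupType) (A B : set G) : set G :=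
  [set a * b | a in A & b in B].

Definition normal_subgroup (G : groupType) (N : set G) : Prop :=
  group_closed [in N] /\ forall n g : G, N n -> N (n ^ g).

Definition coset (G : groupType) (g : G) (N : set G) : set G :=
  complex_prod [set g] N.

Definition quotient (G : groupType) (N : set G) : set (set G) :=
  [set coset g N | g in [set: G]].

(** [f] is only meaningful on the cosets of [N]. *)
Definition quotient_isomorphism (G G' : groupType) (N : set G) (N' : set G')
    (f : set G -> set G') : Prop :=
  set_bij (quotient N) (quotient N') f /\
  forall C D, quotient N C -> quotient N D ->
    f (complex_prod C D) = complex_prod (f C) (f D).

(** The set written $f[S]$. For a normal subgroup M containing N, the map
    induced by [f] modulo M is the restriction of [coset_image N f] to
    [quotient M]. *)
Definition coset_image (G G' : groupType) (N : set G)
    (f : set G -> set G') (S : set G) : set G' :=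
  \bigcup_(C in [set C | quotient N C /\ C `<=` S]) f C.

(** * Group pairs and group frames *)

(** The groups are the members of a family of types, so that their disjoint
    union is a sigma type. The data [gp_H], [gp_K], [gp_phi] are total
    in the indices and unconstrained (and never used) outside of [gp_E]. *)
Record group_pair := GroupPair {
  gp_I : Type;
  gp_G : gp_I -> groupType;
  gp_E : gp_I -> gp_I -> Prop;
  gp_H : forall x y : gp_I, set (gp_G x);
  gp_K : forall x y : gp_I, set (gp_G y);
  gp_phi : forall x y : gp_I, set (gp_G x) -> set (gp_G y);
  gp_E_equiv : RelationClasses.Equivalence gp_E;
  gp_H_normal : forall x y, gp_E x y -> normal_subgroup (@gp_H x y);
  gp_K_normal : forall x y, gp_E x y -> normal_subgroup (@gp_K x y);
  gp_phi_iso : forall x y, gp_E x y ->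
    quotient_isomorphism (@gp_H x y) (@gp_K x y) (@gp_phi x y)
}.

Arguments gp_H : clear implicits.
Arguments gp_K : clear implicits.
Arguments gp_phi : clear implicits.

Record is_group_frame (F : group_pair) : Prop := {
  gf_refl : forall x : gp_I F,
    [/\ gp_H F x x = [set 1],
        gp_K F x x = [set 1]
      & forall C, quotient [set 1] C -> gp_phi F x x C = C];
  gf_sym : forall x y : gp_I F, gp_E x y ->
    [/\ gp_H F y x = gp_K F x y,
        gp_K F y x = gp_H F x y,
        forall C, quotient (gp_H F x y) C ->
          gp_phi F y x (gp_phi F x y C) = C
      & forall D, quotient (gp_K F x y) D ->
          gp_phi F x y (gp_phi F y x D) = D];
  gf_image : forall x y z : gp_I F, gp_E x y -> gp_E y z ->
    coset_image (gp_H F x y) (gp_phi F x y)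
      (complex_prod (gp_H F x y) (gp_H F x z))
    = complex_prod (gp_K F x y) (gp_H F y z);
  gf_trans : forall x y z : gp_I F, gp_E x y -> gp_E y z ->
    forall C, quotient (complex_prod (gp_H F x y) (gp_H F x z)) C ->
      coset_image (gp_H F y z) (gp_phi F y z)
        (coset_image (gp_H F x y) (gp_phi F x y) C)
      = coset_image (gp_H F x z) (gp_phi F x z) C
}.

Record group_frame := GroupFrame {
  gf_pair :> group_pair;
  gf_frame : is_group_frame gf_pair
}.

Definition gf_simple (F : group_frame) : Prop :=
  inhabited (gp_I F) /\ forall x y : gp_I F, gp_E x y.

(** * The full group relation algebra *)

Definition gr_base (F : group_pair) : Type := {x : gp_I F & gp_G x}.

Definition gr_unit (F : group_pair) : set (gr_base F * gr_base F) :=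
  [set p | gp_E (tag p.1) (tag p.2)].

Arguments gr_unit : clear implicits.

(** $R_{xy,\alpha}$, where the cosets of $H_{xy}$ are indexed by themselves:
    the index is the coset [A] $= H_{xy,\alpha}$. *)
Definition gr_atom (F : group_pair) (x y : gp_I F) (A : set (gp_G x)) :
    set (gr_base F * gr_base F) :=
  \bigcup_(C in quotient (gp_H F x y))
    [set (Tagged (@gp_G F) a, Tagged (@gp_G F) b)
       | a in C & b in complex_prod (gp_phi F x y C) (gp_phi F x y A)].

Definition gr_atoms (F : group_pair) : set (set (gr_base F * gr_base F)) :=
  [set R | exists x y A,
     [/\ gp_E x y, quotient (gp_H F x y) A & R = gr_atom y A]].

Arguments gr_atoms : clear implicits.

Definition gr_universe (F : group_pair) : set (set (gr_base F * gr_base F)) :=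
  [set X | exists2 S, S `<=` gr_atoms F & X = \bigcup_(R in S) R].

Arguments gr_universe : clear implicits.

Section Cosets.
Variable G : groupType.
Implicit Types (g h : G) (N A B C : set G).

Lemma complex_prodP A B g :
  complex_prod A B g <-> exists a b, [/\ A a, B b & a * b = g].
Proof.
split=> [[a Aa [b Bb <-]]|[a [b [Aa Bb <-]]]]; first by exists a, b.
by exists a => //; exists b.
Qed.

Section Normal.
Variable N : set G.
Hypothesis nN : normal_subgroup N.

Lemma normal1 : N 1.
Proof. by case: nN => -[+ _] _; rewrite inE. Qed.

Lemma normalF g h : N g -> N h -> N (g / h).
Proof. by case: nN => -[_ +] _ => /(_ g h); rewrite !inE. Qed.

Lemma normalV g : N g -> N g^-1.
Proof. by rewrite -(mul1g g^-1); apply: normalF; exact: normal1. Qed.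

Lemma normalM g h : N g -> N h -> N (g * h).
Proof. by move=> Ng Nh; rewrite -(invgK h); apply/normalF/normalV. Qed.

Lemma normalJ g h : N g -> N (g ^ h).
Proof. by case: nN => _; exact. Qed.

Lemma cosetP g h : coset g N h <-> N (g^-1 * h).
Proof.
split=> [/complex_prodP[_ [n [-> Nn <-]]]|Ngh]; first by rewrite mulKg.
by apply/complex_prodP; exists g, (g^-1 * h); rewrite mulVKg.
Qed.

Lemma coset_refl g : coset g N g.
Proof. by apply/cosetP; rewrite mulVg; exact: normal1. Qed.

Lemma coset_eq g h : coset g N h -> coset g N = coset h N.
Proof.
move=> /cosetP Ngh; apply/seteqP; split=> k /cosetP Nk; apply/cosetP.
  have -> : h^-1 * k = (g^-1 * h)^-1 * (g^-1 * k).
    by rewrite invgM invgK -mulgA mulVKg.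
  exact/normalM/Nk/normalV.
have -> : g^-1 * k = (g^-1 * h) * (h^-1 * k) by rewrite -mulgA mulVKg.
exact: normalM.
Qed.

Lemma quotient_coset g : quotient N (coset g N).
Proof. by exists g. Qed.

Lemma quotient_eq C g : quotient N C -> C g -> C = coset g N.
Proof. by move=> [h _ <-] /coset_eq. Qed.

Lemma cosetM g h :
  complex_prod (coset g N) (coset h N) = coset (g * h) N.
Proof.
apply/seteqP; split=> k.
  move=> /complex_prodP[a [b [/cosetP Na /cosetP Nb <-]]]; apply/cosetP.
  have -> : (g * h)^-1 * (a * b) = (g^-1 * a) ^ h * (h^-1 * b).
    by rewrite conjgE invgM !mulgA mulgK.
  by apply/normalM/Nb/normalJ.
move=> /cosetP Nk; apply/complex_prodP; exists g, (g^-1 * k); split.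
- exact: coset_refl.
- by apply/cosetP; rewrite mulgA -invgM.
- by rewrite mulVKg.
Qed.

End Normal.
End Cosets.

Section QuotientIso.
Variables (G G' : groupType) (N : set G) (N' : set G') (f : set G -> set G').
Hypotheses (nN : normal_subgroup N) (nN' : normal_subgroup N').
Hypothesis fI : quotient_isomorphism N N' f.

Lemma quotient_iso_cosetE g g' :
  f (coset g N) g' -> f (coset g N) = coset g' N'.
Proof.
case: fI => -[fN _ _] _; apply: quotient_eq => //.
exact/fN/quotient_coset.
Qed.

Lemma quotient_iso_ex g : exists g', f (coset g N) = coset g' N'.
Proof.
case: fI => -[fN _ _] _.
by have [g' _ <-] := fN _ (quotient_coset N g); exists g'.
Qed.

Lemma quotient_isoM g h g' h' : f (coset g N) g' -> f (coset h N) h' ->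
  f (coset (g * h) N) (g' * h').
Proof.
move=> fg fh; rewrite -cosetM//.
case: fI => _ ->; try exact: quotient_coset.
by apply/complex_prodP; exists g', h'.
Qed.

Lemma quotient_iso1 : f (coset 1 N) 1.
Proof.
have [u fu] := quotient_iso_ex 1.
have fuu : f (coset 1 N) u by rewrite fu; exact: coset_refl.
have := quotient_isoM fuu fuu; rewrite mul1g.
rewrite fu => /cosetP; rewrite mulKg => Nu.
by apply/cosetP; rewrite mulg1; exact: normalV.
Qed.

Lemma quotient_isoV g g' : f (coset g N) g' -> f (coset g^-1 N) g'^-1.
Proof.
move=> fg; have [u fu] := quotient_iso_ex g^-1.
have fuu : f (coset g^-1 N) u by rewrite fu; exact: coset_refl.
have := quotient_isoM fuu fg; rewrite mulVg => f1.
have := quotient_iso1; rewrite (quotient_iso_cosetE f1) => /cosetP.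
rewrite mulg1 => Nu; rewrite fu; apply/cosetP.
have -> : u^-1 * g'^-1 = (u * g')^-1 ^ g'^-1.
  by rewrite conjgE invgM invgK !mulgA mulgV mul1g.
exact: normalJ.
Qed.

End QuotientIso.

Section GroupFrame.
Variable F : group_frame.

Local Notation I := (gp_I F).
Local Notation pt := (Tagged (@gp_G F)).
Lemma gf_E_refl (x : I) : gp_E x x.
Proof. by case: (gp_E_equiv F) => + _ _; exact. Qed.
Lemma gf_E_sym (x y : I) : gp_E x y -> gp_E y x.
Proof. by case: (gp_E_equiv F) => _ + _; exact. Qed.
Lemma gf_E_trans (x y z : I) : gp_E x y -> gp_E y z -> gp_E x z.
Proof. by case: (gp_E_equiv F) => _ _; exact. Qed.
Lemma gf_H_normal (x y : I) : gp_E x y -> normal_subgroup (gp_H F x y).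
Proof. exact: gp_H_normal. Qed.
Lemma gf_K_normal (x y : I) : gp_E x y -> normal_subgroup (gp_K F x y).
Proof. exact: gp_K_normal. Qed.

(** The graph of $\varphi_{xy}$ on group elements. Two pairs $(a,b)$, $(a',b')$
    in $G_x\times G_y$ are in the same atom if and only if $a'a^{-1}$ and
    $b'b^{-1}$ are linked. *)
Definition gf_link (x y : gp_I F) (a : gp_G x) (b : gp_G y) : Prop :=
  gp_phi F x y (coset a (gp_H F x y)) b.

Lemma gf_linkM (x y : I) (a a' : gp_G x) (b b' : gp_G y) : gp_E x y ->
  gf_link a b -> gf_link a' b' -> gf_link (a * a') (b * b').
Proof.
by move=> Exy; apply: quotient_isoM (gf_H_normal Exy) (gp_phi_iso Exy) _ _ _ _.
Qed.

Lemma gf_linkV (x y : I) (a : gp_G x) (b : gp_G y) : gp_E x y ->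
  gf_link a b -> gf_link a^-1 b^-1.
Proof.
move=> Exy.
exact: quotient_isoV (gf_H_normal Exy) (gf_K_normal Exy) (gp_phi_iso Exy) _ _.
Qed.

Lemma gf_link_sym (x y : I) (a : gp_G x) (b : gp_G y) : gp_E x y ->
  gf_link a b -> gf_link b a.
Proof.
move=> Exy; rewrite /gf_link => ab.
have [HK _ phiK _] := gf_sym (gf_frame F) Exy.
rewrite HK -(quotient_iso_cosetE (gf_K_normal Exy) (gp_phi_iso Exy) ab).
by rewrite phiK; [exact/coset_refl/gf_H_normal|exact: quotient_coset].
Qed.

Lemma gf_link_refl (x : I) (a a' : gp_G x) : gf_link a a' -> a = a'.
Proof.
have [H1 _ phi1] := gf_refl (gf_frame F) x.
rewrite /gf_link H1 phi1; last exact: quotient_coset.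
by move=> /complex_prodP[_ [_ [-> -> <-]]]; rewrite mulg1.
Qed.

Lemma gf_link_trans (x y z : I) (a : gp_G x) (c : gp_G z) :
  gp_E x y -> gp_E y z -> gf_link a c ->
  exists2 b : gp_G y, gf_link a b & gf_link b c.
Proof.
move=> Exy Eyz ac; have Exz := gf_E_trans Exy Eyz.
set M := complex_prod (gp_H F x y) (gp_H F x z).
have HM : coset a (gp_H F x z) `<=` coset a M.
  move=> g /complex_prodP[_ [h [-> Hh <-]]]; apply/complex_prodP; exists a, h.
  by split=> //; apply/complex_prodP; exists 1, h; rewrite mul1g;
    split=> //; exact: (normal1 (gf_H_normal _)).
have : coset_image (gp_H F x z) (gp_phi F x z) (coset a M) c.
  by exists (coset a (gp_H F x z)) => //; split=> //; exact: quotient_coset.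
rewrite -(gf_trans (gf_frame F) Exy Eyz); last exact: quotient_coset.
move=> [D [qD Dsub] Dc].
have [d Dd] : exists d, D d.
  by move: qD => [d _ <-]; exists d; exact/coset_refl/gf_H_normal.
have [C [qC Csub] Cd] := Dsub _ Dd.
have [g Cg] : exists g, C g.
  by move: qC => [g _ <-]; exists g; exact/coset_refl/gf_H_normal.
have gd : gf_link g d.
  by rewrite /gf_link -(quotient_eq (gf_H_normal Exy) qC Cg).
have [u au] := quotient_iso_ex (gp_phi_iso Exy) a.
have {au} au : gf_link a u by rewrite /gf_link au; exact/coset_refl/gf_K_normal.
have aud := gf_linkM Exy (gf_linkV Exy au) gd.
have : complex_prod (gp_K F x y) (gp_H F y z) (u^-1 * d).
  rewrite -(gf_image (gf_frame F) Exy Eyz).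
  exists (coset (a^-1 * g) (gp_H F x y)) => //; split.
    exact: quotient_coset.
  move=> k /cosetP Hk.
  have Cak : coset a M (a * k).
    apply: Csub; rewrite (quotient_eq (gf_H_normal Exy) qC Cg); apply/cosetP.
    by move: Hk; rewrite invgM invgK mulgA.
  by move: Cak => /cosetP; rewrite mulKg.
move=> /complex_prodP[k [h [Kk Hh kh]]]; exists (u * k).
  rewrite /gf_link (quotient_iso_cosetE (gf_K_normal Exy) (gp_phi_iso Exy) au).
  by apply/cosetP; rewrite mulKg.
rewrite /gf_link; suff -> : coset (u * k) (gp_H F y z) = D by [].
rewrite (quotient_eq (gf_H_normal Eyz) qD Dd); apply: coset_eq.
  exact: gf_H_normal.
apply/cosetP; suff -> : (u * k)^-1 * d = h by [].
by rewrite invgM -mulgA -kh mulKg.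
Qed.

(** Invariance under [gf_link], which characterizes the universe. *)
Definition gr_invariant (X : set (gr_base F * gr_base F)) : Prop :=
  forall (x y : gp_I F) (a a' : gp_G x) (b b' : gp_G y),
    gf_link (a' * a^-1) (b' * b^-1) ->
    X (Tagged (@gp_G F) a, Tagged (@gp_G F) b) ->
    X (Tagged (@gp_G F) a', Tagged (@gp_G F) b').

Lemma gf_Tagged_inj (x : I) : injective (fun a : gp_G x => pt a).
Proof.
move=> a a' e; have := projT2_eq e.
by rewrite (Prop_irrelevance (projT1_eq e) erefl).
Qed.

Lemma gr_atomP (x y : I) (A : set (gp_G x)) (a : gp_G x) (b : gp_G y) :
  gp_E x y ->
  gr_atom y A (pt a, pt b) <->
  complex_prod (gp_phi F x y (coset a (gp_H F x y))) (gp_phi F x y A) b.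
Proof.
move=> Exy; split=> [[C qC [a' Ca' [b' b'P]]]|bP].
  move=> [/gf_Tagged_inj <- /gf_Tagged_inj <-].
  by rewrite -(quotient_eq (gf_H_normal Exy) qC Ca').
exists (coset a (gp_H F x y)); first exact: quotient_coset.
by exists a; [exact/coset_refl/gf_H_normal|exists b].
Qed.

Lemma gr_atom_ex (x y : I) (a : gp_G x) (b : gp_G y) : gp_E x y ->
  exists2 A, quotient (gp_H F x y) A & gr_atom y A (pt a, pt b).
Proof.
move=> Exy; have [u au] := quotient_iso_ex (gp_phi_iso Exy) a.
have {}au : gf_link a u by rewrite /gf_link au; exact/coset_refl/gf_K_normal.
have [[_ _ /(_ _ (quotient_coset _ (u^-1 * b)))] [A qA Ae] _] := gp_phi_iso Exy.
exists A => //; apply/(gr_atomP _ _ _ Exy)/complex_prodP.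
exists u, (u^-1 * b); split=> //; last by rewrite mulVKg.
by rewrite Ae; exact/coset_refl/gf_K_normal.
Qed.

Lemma gr_atom_link (x y : I) (A : set (gp_G x)) (a a' : gp_G x)
    (b b' : gp_G y) : gp_E x y -> quotient (gp_H F x y) A ->
  gr_atom y A (pt a, pt b) ->
  gr_atom y A (pt a', pt b') <-> gf_link (a' * a^-1) (b' * b^-1).
Proof.
move=> Exy qA /(gr_atomP _ _ _ Exy)/complex_prodP[u [v [au Av uvb]]].
have [Hn Kn iso] := And3 (gf_H_normal Exy) (gf_K_normal Exy) (gp_phi_iso Exy).
have qAv : gp_phi F x y A = coset v (gp_K F x y).
  apply: quotient_eq => //; case: iso => -[+ _ _] _; exact.
split=> [/(gr_atomP _ _ _ Exy)/complex_prodP[u' [v' [au' Av' uvb']]]|abl].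
  have : gf_link (a' * a^-1) (u' * u^-1).
    exact/gf_linkM/gf_linkV.
  rewrite /gf_link => /(quotient_iso_cosetE Kn iso) ->.
  apply/cosetP; move: Av'; rewrite qAv => /cosetP Kv.
  have -> : (u' * u^-1)^-1 * (b' * b^-1) = ((v^-1 * v') ^ v^-1) ^ u^-1.
    by rewrite -uvb -uvb' !conjgE !invgM !invgK !mulgA mulgVK mulgK.
  by do 2!apply: normalJ => //.
apply/(gr_atomP _ _ _ Exy)/complex_prodP; exists (b' * b^-1 * u), v; split=> //.
  rewrite -[a'](mulgVK a); exact: gf_linkM.
by rewrite -mulgA uvb mulgVK.
Qed.

Lemma gr_universeP (X : set (gr_base F * gr_base F)) :
  gr_universe F X <-> X `<=` gr_unit F /\ gr_invariant X.
Proof.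
split=> [[S Sat ->]|[XE Xinv]].
  split=> [p [R SR Rp]|x y a a' b b' ab [R SR Rab]].
    have [x [y [A [Exy qA RA]]]] := Sat _ SR.
    by move: Rp; rewrite RA => -[C qC [a Ca [b b'P <-]]].
  exists R => //; have [x' [y' [A [Exy qA RA]]]] := Sat _ SR.
  move: (Rab); rewrite {1}RA => -[C qC [a1 Ca [b1 b1P [xx' aa' yy' bb']]]].
  subst x' y' R; by apply/(gr_atom_link _ _ Exy qA Rab).
exists [set R | gr_atoms F R /\ R `<=` X]; first by move=> R [].
apply/seteqP; split=> [[[x a] [y b]] Xab|p [R [_ RX] /RX//]].
have Exy : gp_E x y := XE _ Xab.
have [A qA Aab] := gr_atom_ex a b Exy.
exists (gr_atom y A) => //; split; first by exists x, y, A.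
move=> p Ap; move: (Ap) => [C qC [a' Ca' [b' b'P pE]]].
rewrite -pE in Ap *; apply: Xinv Xab.
by apply/(gr_atom_link _ _ Exy qA Aab).
Qed.

Lemma gr_universeU X Y :
  gr_universe F X -> gr_universe F Y -> gr_universe F (X `|` Y).
Proof.
move=> /gr_universeP[XE Xi] /gr_universeP[YE Yi]; apply/gr_universeP; split.
  by rewrite subUset.
by move=> x y a a' b b' l [/(Xi _ _ _ _ _ _ l)|/(Yi _ _ _ _ _ _ l)];
  [left|right].
Qed.

Lemma gr_universeC X : gr_universe F X -> gr_universe F (gr_unit F `\` X).
Proof.
move=> /gr_universeP[XE Xi]; apply/gr_universeP; split=> [p []//|].
move=> x y a a' b b' l [Exy nX]; split=> // Xab; apply: nX.
apply: Xi Xab; have := gf_linkV Exy l.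
by rewrite !invgM !invgK.
Qed.

Lemma gr_universe_comp X Y : gr_universe F X -> gr_universe F Y ->
  gr_universe F (Y \; X)%relation.
Proof.
move=> /gr_universeP[XE Xi] /gr_universeP[YE Yi]; apply/gr_universeP; split.
  by move=> p [q /XE Eq /YE]; exact: gf_E_trans.
move=> x z a a' c c' l [[y b] Xab Ybc].
have [r ar rc] := gf_link_trans (XE _ Xab) (YE _ Ybc) l.
exists (pt (r * b)).
  by apply: Xi Xab; rewrite mulgK.
by apply: Yi Ybc; rewrite mulgK.
Qed.

Lemma gr_universeV X : gr_universe F X -> gr_universe F (X^-1)%relation.
Proof.
move=> /gr_universeP[XE Xi]; apply/gr_universeP; split.
  by move=> p /XE/gf_E_sym.
move=> x y a a' b b' l Xba; apply: Xi (Xba).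
exact/gf_link_sym/l/gf_E_sym/(XE _ Xba).
Qed.

Lemma gr_universe1 : gr_universe F diagonal.
Proof.
apply/gr_universeP; split=> [[p q] /diagonalP ->|]; first exact: gf_E_refl.
move=> x y a a' b b' l /diagonalP e.
have xy : x = y := projT1_eq e; subst y; apply/diagonalP.
move: e l => /gf_Tagged_inj <- /gf_link_refl e; congr (Tagged _ _).
by rewrite -(mulgVK a a') e mulgVK.
Qed.

Definition gr_elt : Type := {X : set (gr_base F * gr_base F) | gr_universe F X}.

Lemma gr_elt_ext (X Y : gr_elt) : (forall p, sval X p <-> sval Y p) -> X = Y.
Proof.
move: X Y => [X uX] [Y uY] /= XY; apply: eq_exist.
by apply/seteqP; split=> p /XY.
Qed.

Definition gr_add (X Y : gr_elt) : gr_elt :=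
  exist _ (sval X `|` sval Y) (gr_universeU (svalP X) (svalP Y)).

Definition gr_compl (X : gr_elt) : gr_elt :=
  exist _ (gr_unit F `\` sval X) (gr_universeC (svalP X)).

(** MathComp's [Y \; X] relates [p] to [q] if [X (p, r)] and [Y (r, q)] for
    some [r]: this is the composition "first X, then Y". *)
Definition gr_comp (X Y : gr_elt) : gr_elt :=
  exist _ (sval Y \; sval X)%relation (gr_universe_comp (svalP X) (svalP Y)).

Definition gr_conv (X : gr_elt) : gr_elt :=
  exist _ ((sval X)^-1)%relation (gr_universeV (svalP X)).

Definition gr_id : gr_elt := exist _ diagonal gr_universe1.

Lemma gr_elt_sub (X : gr_elt) p : sval X p -> gr_unit F p.
Proof. by have /gr_universeP[+ _] := svalP X; exact. Qed.

Lemma gr_addC : commutative gr_add.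
Proof. by move=> X Y; apply: gr_elt_ext => p; rewrite /= /setU /=; tauto. Qed.

Lemma gr_addA : associative gr_add.
Proof. by move=> X Y Z; apply: gr_elt_ext => p; rewrite /= /setU /=; tauto. Qed.

Lemma gr_huntington X Y :
  gr_add (gr_compl (gr_add (gr_compl X) Y))
         (gr_compl (gr_add (gr_compl X) (gr_compl Y))) = X.
Proof.
apply: gr_elt_ext => p /=; rewrite /setU /setD /=; have := @gr_elt_sub X p.
by have [] := (pselect (sval X p), pselect (sval Y p)); tauto.
Qed.

Lemma gr_compA : associative gr_comp.
Proof.
move=> X Y Z; apply: gr_elt_ext => p; split=> /=.
  by move=> [q Xq [r Yr Zr]]; exists r => //; exists q.
by move=> [r [q Xq Yr] Zr]; exists q => //; exists r.
Qed.

Lemma gr_comp_id : right_id gr_id gr_comp.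
Proof.
move=> X; apply: gr_elt_ext => -[p q]; split=> /=.
  by move=> [r Xr /diagonalP <-].
by move=> Xpq; exists q.
Qed.

Lemma gr_convK : involutive gr_conv.
Proof. by move=> X; apply: gr_elt_ext => -[]. Qed.

Lemma gr_conv_comp X Y :
  gr_conv (gr_comp X Y) = gr_comp (gr_conv Y) (gr_conv X).
Proof. by apply: gr_elt_ext => p; split=> -[q ? ?]; exists q. Qed.

Lemma gr_compDl : left_distributive gr_comp gr_add.
Proof.
move=> X Y Z; apply: gr_elt_ext => p; split=> /=.
  by move=> [q [Xq|Yq] Zq]; [left|right]; exists q.
by move=> [] [q Xq Zq]; exists q => //; [left|right].
Qed.

Lemma gr_convD : {morph gr_conv : X Y / gr_add X Y}.
Proof. by move=> X Y; apply: gr_elt_ext. Qed.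

Lemma gr_tarski X Y :
  gr_add (gr_comp (gr_conv X) (gr_compl (gr_comp X Y))) (gr_compl Y)
  = gr_compl Y.
Proof.
apply: gr_elt_ext => -[p q]; split=> /= [|Yq]; last by right.
move=> [[r Xrp [Erq nXY]]|//]; split.
  exact: gf_E_trans (gf_E_sym (gr_elt_sub Xrp)) Erq.
by move=> Ypq; apply: nXY; exists p.
Qed.

Definition full_group_relation_algebra : relation_algebra :=
  RelationAlgebra gr_addC gr_addA gr_huntington gr_compA gr_comp_id gr_convK
    gr_conv_comp gr_compDl gr_convD gr_tarski.

End GroupFrame.

(* Main.v *)
(** If the frame is simple, every nonempty relation X of the algebra satisfies
    1;X;1 = 1; hence a homomorphism identifying two distinct elements collapses
    their symmetric difference, therefore the unit, therefore everything.
    Conversely, restricting relations to the groups indexed by one class of the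
    equivalence on the index set is a non-constant homomorphism into the algebra
    of the restricted frame, and it kills the part of the unit lying over the
    other classes; so there are none. *)
Require Import Defs.
From mathcomp Require Import all_boot.
From mathcomp Require Import boolp classical_sets functions.

Set Implicit Arguments.
Unset Strict Implicit.
Unset Printing Implicit Defensive.

Local Open Scope classical_set_scope.
Local Open Scope group_scope.

(** * Boolean terms preserved by homomorphisms *)

Section Collapse.
Variables (A B : relation_algebra) (h : A -> B).
Hypothesis hom_h : ra_homomorphism h.

Definition ra_symdiff (C : relation_algebra) (r s : C) : C :=
  ra_add (ra_compl (ra_add (ra_compl r) s)) (ra_compl (ra_add r (ra_compl s))).

Definition ra_meet (C : relation_algebra) (r s : C) : C :=
  ra_compl (ra_add (ra_compl r) (ra_compl s)).

Lemma ra_hom_symdiff (r s : A) :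
  h (ra_symdiff r s) = ra_symdiff (h r) (h s).
Proof. by rewrite /ra_symdiff !(ra_homD hom_h, ra_homN hom_h). Qed.

Lemma ra_hom_meet (r s : A) : h (ra_meet r s) = ra_meet (h r) (h s).
Proof. by rewrite /ra_meet !(ra_homD hom_h, ra_homN hom_h). Qed.

End Collapse.

(** * Simple frames give simple algebras *)

Section Elements.
Variable F : group_frame.
Local Notation A := (full_group_relation_algebra F).

Lemma gr_universe0 : gr_universe F set0.
Proof. by apply/gr_universeP; split=> [p []|x y a a' b b' _ []]. Qed.

Definition gr_zero : A := exist _ set0 gr_universe0.

(** The Boolean unit $E$, as opposed to the identity [gr_id] of composition. *)
Definition gr_one : A := gr_compl gr_zero.

Lemma gr_oneP p : sval gr_one p <-> gr_unit F p.
Proof. by split=> [[]|Ep] //; split. Qed.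

Lemma gr_symdiffP (X Y : A) p :
  sval (ra_symdiff X Y) p <-> (sval X p /\ ~ sval Y p) \/ (sval Y p /\ ~ sval X p).
Proof.
have [XE YE] := (@gr_elt_sub F X p, @gr_elt_sub F Y p).
rewrite /= /setU /setD /=.
by have [] := (pselect (sval X p), pselect (sval Y p)); tauto.
Qed.

Lemma gr_symdiffxx (X : A) : ra_symdiff X X = gr_zero.
Proof. by apply: gr_elt_ext => p; rewrite gr_symdiffP /=; tauto. Qed.

Lemma gr_symdiff_neq0 (X Y : A) : X <> Y -> exists p, sval (ra_symdiff X Y) p.
Proof.
move=> XY; apply: contrapT => no; apply: XY; apply: gr_elt_ext => p.
have : ~ sval (ra_symdiff X Y) p by move=> ?; apply: no; exists p.
rewrite gr_symdiffP.
by have [] := (pselect (sval X p), pselect (sval Y p)); tauto.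
Qed.

Lemma gr_meetx1 (X : A) : ra_meet X gr_one = X.
Proof.
apply: gr_elt_ext => p; have := @gr_elt_sub F X p.
rewrite /= /setU /setD /=.
by have := pselect (sval X p); tauto.
Qed.

Lemma gr_meetx0 (X : A) : ra_meet X gr_zero = gr_zero.
Proof.
apply: gr_elt_ext => p; have := @gr_elt_sub F X p.
rewrite /= /setU /setD /=; tauto.
Qed.

Lemma gr_comp0 : ra_comp (ra_comp gr_one gr_zero) gr_one = gr_zero.
Proof. by apply: gr_elt_ext => p; split=> [[q [r _ []]]|[]]. Qed.

(** In a simple frame all pairs lie in the unit, so a single pair $(p,q)$ of [X] connects any $p'$
    to any $q'$ along $p',p,q,q'$. *)
Lemma gr_comp_neq0 (X : A) : gf_simple F -> (exists p, sval X p) ->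
  ra_comp (ra_comp gr_one X) gr_one = gr_one.
Proof.
move=> [_ Etot] [[p q] Xpq]; apply: gr_elt_ext => -[p' q']; split=> _.
  by apply/gr_oneP; exact: Etot.
by exists q; [exists p => //|]; apply/gr_oneP; exact: Etot.
Qed.

Lemma gr_one_neq0 : inhabited (gp_I F) -> gr_one <> gr_zero.
Proof.
move=> [x] /(congr1 sval) e; pose p : gr_base F := Tagged (@gp_G F) (1 : gp_G x).
have : sval gr_one (p, p) by apply/gr_oneP; exact: gf_E_refl.
by rewrite e.
Qed.

Lemma gf_simple_ra_simple : gf_simple F -> ra_simple A.
Proof.
move=> sF; split; first by exists gr_one, gr_zero; apply: gr_one_neq0; case: sF.
move=> B h hom_h ncst X Y hXY; apply: contrapT => XY; apply: ncst.
have hD : h (ra_symdiff X Y) = h gr_zero.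
  by rewrite ra_hom_symdiff// hXY -ra_hom_symdiff// gr_symdiffxx.
(* Composing with the unit on both sides turns the nonempty symmetric difference into the unit and
   keeps zero at zero. *)
have h1 : h gr_one = h gr_zero.
  rewrite -(gr_comp_neq0 sF (gr_symdiff_neq0 XY)) -[in RHS]gr_comp0.
  by rewrite !(ra_homM hom_h) hD.
(* Meeting [Z] with the unit gives [Z], and with zero gives zero. *)
have h0 Z : h Z = h gr_zero.
  by rewrite -{1}(gr_meetx1 Z) ra_hom_meet// h1 -ra_hom_meet// gr_meetx0.
by move=> Z T; rewrite !h0.
Qed.

End Elements.

(** * Restriction to one class of the equivalence *)

Section Restriction.
Variables (F : group_frame) (x0 : gp_I F).

Definition class_index : Type := {x : gp_I F | gp_E x0 x}.

Definition class_E (x y : class_index) : Prop := gp_E (sval x) (sval y).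

Lemma class_E_equiv : RelationClasses.Equivalence class_E.
Proof.
split=> [x|x y|x y z]; [exact: gf_E_refl|exact: gf_E_sym|exact: gf_E_trans].
Qed.

Definition class_pair : group_pair :=
  @GroupPair class_index (fun x => gp_G (sval x)) class_E
    (fun x y => gp_H F (sval x) (sval y)) (fun x y => gp_K F (sval x) (sval y))
    (fun x y => gp_phi F (sval x) (sval y)) class_E_equiv
    (fun x y => @gp_H_normal F (sval x) (sval y))
    (fun x y => @gp_K_normal F (sval x) (sval y))
    (fun x y => @gp_phi_iso F (sval x) (sval y)).

(** Each frame condition speaks only of the indices it quantifies over, so it is inherited from
    [F]. *)
Lemma class_pair_frame : is_group_frame class_pair.
Proof.
split=> [x|x y|x y z|x y z].
- exact: (gf_refl (gf_frame F) (sval x)).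
- exact: (@gf_sym _ (gf_frame F) (sval x) (sval y)).
- exact: (@gf_image _ (gf_frame F) (sval x) (sval y) (sval z)).
- exact: (@gf_trans _ (gf_frame F) (sval x) (sval y) (sval z)).
Qed.

Definition class_frame : group_frame := GroupFrame class_pair_frame.

Definition class_incl (p : gr_base class_frame) : gr_base F :=
  Tagged (@gp_G F) (tagged p : gp_G (sval (tag p))).

(** Indices of the class over the same index of [F] differ only in their membership proofs, which
    are equal by proof irrelevance. *)
Lemma class_incl_inj : injective class_incl.
Proof.
move=> [[x Ex] a] [[y Ey] b] e; have xy : x = y := projT1_eq e.
subst y; rewrite (Prop_irrelevance Ey Ex) in b e *.
by move: e => /gf_Tagged_inj /= ->.
Qed.

Lemma class_incl_ex (q : gr_base F) :
  gp_E x0 (tag q) -> exists r, class_incl r = q.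
Proof.
move: q => [y b] Ey.
by exists (Tagged (@gp_G class_frame) (b : @gp_G class_frame (exist _ y Ey))).
Qed.

Definition class_restr (X : set (gr_base F * gr_base F)) :
    set (gr_base class_frame * gr_base class_frame) :=
  [set p | X (class_incl p.1, class_incl p.2)].

(** [gf_link] in the class frame unfolds to [gf_link] in [F], so invariance carries over. *)
Lemma class_restr_universe X :
  gr_universe F X -> gr_universe class_frame (class_restr X).
Proof.
move=> /gr_universeP[XE Xi]; apply/gr_universeP; split=> [p /XE//|].
by move=> x y a a' b b' l; exact: Xi.
Qed.

Definition class_hom (X : full_group_relation_algebra F) :
    full_group_relation_algebra class_frame :=
  exist _ (class_restr (sval X)) (class_restr_universe (svalP X)).

Lemma class_homP : ra_homomorphism class_hom.
Proof.
split=> [X Y|X|X Y|X|]; apply: gr_elt_ext => -[p q] //=.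
- split=> [[r Xr Yr]|[r Xr Yr]]; last by exists (class_incl r).
  (* The intermediate point [r] stays in the class, since relations of the algebra lie inside the
     unit. *)
  have [|r' er] := @class_incl_ex r; last by exists r'; rewrite /class_restr/= er.
  exact: gf_E_trans (svalP (tag p)) (gr_elt_sub Xr).
- split=> [/diagonalP/class_incl_inj/= ->|/diagonalP/= ->]; exact/diagonalP.
Qed.

(** Invariance changes group elements but not indices, and this relation depends on indices only. *)
Lemma off_class_universe :
  gr_universe F (gr_unit F `&` [set p | ~ gp_E x0 (tag p.1)]).
Proof.
by apply/gr_universeP; split=> [p []//|].
Qed.

Lemma ra_simple_class (y : gp_I F) :
  ra_simple (full_group_relation_algebra F) -> gp_E x0 y.
Proof.
move=> [_ /(_ _ _ class_homP) inj]; apply: contrapT => nE.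
pose O : full_group_relation_algebra F := exist _ _ off_class_universe.
(* The identity of $G_{x_0}$ paired with itself survives in the restricted unit, but not in the
   restricted zero. *)
have ncst : ~ forall X Y, class_hom X = class_hom Y.
  move=> /(_ (gr_one F) (gr_zero F)) /(congr1 sval) /= e.
  have [p ep] := @class_incl_ex (Tagged (@gp_G F) (1 : gp_G x0)) (gf_E_refl x0).
  have : class_restr (gr_unit F `\` set0) (p, p) by split=> //; exact: gf_E_refl.
  by rewrite e.
have OZ : O = gr_zero F.
  apply: inj ncst _ _ _; apply: gr_elt_ext => -[p q]; split=> //= -[_ /=].
  by case; exact: (svalP (tag p)).
(* As [y] is outside the class of [x0], this point paired with itself lies in [O], so [O] is not
   zero. *)
pose p : gr_base F := Tagged (@gp_G F) (1 : gp_G y).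
have : sval O (p, p) by split=> //; exact: gf_E_refl.
by rewrite OZ.
Qed.

End Restriction.

(** Two distinct elements differ at some pair of points, and a point carries an index. *)
Lemma ra_simple_inhabited (F : group_frame) :
  ra_simple (full_group_relation_algebra F) -> inhabited (gp_I F).
Proof.
move=> [[X [Y XY]] _]; have [[[x _] _] _] := gr_symdiff_neq0 XY.
exact: (inhabits x).
Qed.

Theorem theorem6p1 (F : group_frame) :
  ra_simple (full_group_relation_algebra F) <-> gf_simple F.
Proof.
split=> [sA|]; last exact: gf_simple_ra_simple.
by split=> [|x y]; [exact: ra_simple_inhabited|exact: ra_simple_class].
Qed.
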